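(* Let $G$ be a graph with $n$ vertices, $m\geq 1$ edges and $t(G)$ triangles. Then \[ \mu_n(G)\leq \frac{3n^3\,t(G)-4m^3}{nm(n^2-2m)}, \] with equality if and only if $G$ is a regular complete multipartite graph, i.e. a complete $k$-partite graph for some $k\geq 2$ with all $k$ parts of equal size.
   Context: All graphs are finite, simple and undirected. $t(G)$ is the number of triangles in $G$. For a graph $G$ of order $n$, the eigenvalues of its adjacency matrix $A(G)$ are $\mu_1(G)\geq\dots\geq\mu_n(G)$; $\mu_n(G)$ is the smallest adjacency eigenvalue. *)

(* Defs.v *)
From HB Require Import structures.
From mathcomp Require Import all_boot all_order all_algebra.
Set Implicit Arguments. Unset Strict Implicit. Unset Printing Implicit Defensive.
Import Order.TTheory GRing.Theory Num.Theory.
Local Open Scope ring_scope.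

Definition simple_graph (n : nat) (e : rel 'I_n) : Prop :=
  symmetric e /\ irreflexive e.

Definition num_edges (n : nat) (e : rel 'I_n) : nat :=
  #|[set S : {set 'I_n} | (#|S| == 2)%N &&
       [forall x in S, forall y in S, (x != y) ==> e x y]]|.

Definition num_triangles (n : nat) (e : rel 'I_n) : nat :=
  #|[set S : {set 'I_n} | (#|S| == 3)%N &&
       [forall x in S, forall y in S, (x != y) ==> e x y]]|.

Definition adj_mx (R : rcfType) (n : nat) (e : rel 'I_n) : 'M[R]_n :=
  \matrix_(i, j) (e i j)%:R.

Definition is_smallest_adj_eigenvalue (R : rcfType) (n : nat) (e : rel 'I_n)
    (mu : R) : Prop :=
  eigenvalue (adj_mx R e) mu /\
  (forall a : R, eigenvalue (adj_mx R e) a -> mu <= a).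

Definition regular_complete_multipartite (n : nat) (e : rel 'I_n) : Prop :=
  exists (k : nat) (f : 'I_n -> 'I_k),
    [/\ (2 <= k)%N,
        (forall i : 'I_k, (0 < #|[set x | f x == i]|)%N),
        (forall i j : 'I_k, #|[set x | f x == i]| = #|[set x | f x == j]|) &
        (forall x y, e x y = (f x != f y))].

(* Main.v *)
(** Put [c = 2m/n^2], [J] the all-ones matrix and [B = A - cJ].  As [A - mu I] is
positive semidefinite, [tr (B (A - mu I) B) >= 0].  Expanding the trace with
[tr A^3 = 6t], [tr A^2 = 2m] and [1 A^2 1^T = \sum_i d_i^2 >= 4m^2/n] yields the
bound, so equality means that the graph is regular and that [B A = mu B].  Then
[A^2 = mu A + c(d - mu)J], where [c(d - mu)] must be the diagonal entry [d]:
nonadjacent vertices have [d] common neighbours, hence the same neighbourhood,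
and nonadjacency is an equivalence relation with classes of size [n - d].
Conversely, a complete multipartite graph with parts of size [s] satisfies
[A^2 = (n - s)J - sA], whence [B A = - s B] and [mu = - s]. *)

Require Import Defs.
From HB Require Import structures.
From mathcomp Require Import all_boot all_order all_algebra.
From mathcomp Require Import complex ring lra.
Set Implicit Arguments. Unset Strict Implicit. Unset Printing Implicit Defensive.
Import Order.TTheory GRing.Theory Num.Theory.

(** * Edges and triangles counted by adjacency indicators *)

Lemma sum_nat_bool (T : finType) (P Q : pred T) :
  (\sum_(x | P x) Q x = #|[pred x | P x && Q x]|)%N.
Proof. by rewrite -sum1_card big_mkcondr; apply: eq_bigr => x _; case: (Q x). Qed.

Lemma cliqueP n (e : rel 'I_n) (S : {set 'I_n}) :
  reflect {in S &, forall x y, x != y -> e x y}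
    [forall x in S, forall y in S, (x != y) ==> e x y].
Proof.
apply: (iffP forall_inP) => [H x y xS yS|H x xS].
  by move/forall_inP/(_ y yS)/implyP: (H x xS).
by apply/forall_inP=> y yS; apply/implyP; apply: H.
Qed.

(** Double counting of ordered pairs: each edge, as a set of size 2, arises from its two
    orderings. *)
Lemma sum_edges n (e : rel 'I_n) : simple_graph e ->
  (\sum_i \sum_j e i j = 2 * num_edges e)%N.
Proof.
move=> [symE irrE]; rewrite /num_edges; set C := [set S | _].
(* Adjacent [i] and [j] lie together in exactly one 2-clique, namely [[set i; j]]. Writing
   [j \in S :\ i] builds in that [j] differs from [i]. *)
have edgeE i j : (e i j = \sum_(S in C) ((i \in S) && (j \in S :\ i)) :> nat)%N.
  rewrite sum_nat_bool (eq_card (B := [pred S | e i j && (S == [set i; j])])).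
    by case: (e i j); rewrite ?card1 ?card0.
  move=> S; rewrite !inE; apply/idP/idP.
    case/andP=> /andP[/eqP cardS /cliqueP clS] /and3P[iS ji jS].
    rewrite clS 1?[i == j]eq_sym //= eq_sym eqEcard subUset !sub1set iS jS.
    by rewrite cardS cards2 eq_sym ji.
  case/andP=> eij /eqP->.
  have ij : i != j by apply: contraTneq eij => ->; rewrite irrE.
  rewrite cards2 ij !inE !eqxx orbT [j == i]eq_sym ij !andbT.
  apply/cliqueP=> x y; rewrite !inE => /pred2P[] -> /pred2P[] ->;
    by rewrite ?eqxx // 1?[e j i]symE.
under eq_bigr => i _ do under eq_bigr => j _ do rewrite edgeE.
under eq_bigr => i _ do rewrite exchange_big.
rewrite exchange_big mulnC -sum_nat_const; apply: eq_bigr => S.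
rewrite inE => /andP[/eqP cS _].
transitivity (\sum_(i in S) 1); last by rewrite sum_nat_const cS.
rewrite [RHS]big_mkcond /=.
apply: eq_bigr => i _.
case: ifP => iS; last by rewrite big1.
by rewrite sum_nat_bool; have := cardsD1 i S; rewrite cS iS => -[].
Qed.

(** A closed walk of length 3 visits three distinct, mutually adjacent vertices, and each triangle
    carries [3 * 2 * 1] such walks. *)
Lemma sum_triangles n (e : rel 'I_n) : simple_graph e ->
  (\sum_i \sum_j \sum_k (e i j && e j k && e k i) = 6 * num_triangles e)%N.
Proof.
move=> [symE irrE]; rewrite /num_triangles; set C := [set S | _].
have neqE x y : e x y -> x != y by apply: contraTneq => ->; rewrite irrE.
have triE i j k : (e i j && e j k && e k i =
    \sum_(S in C) [&& i \in S, j \in S :\ i & k \in S :\ i :\ j] :> nat)%N.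
  rewrite sum_nat_bool.
  rewrite (eq_card (B := [pred S | (e i j && e j k && e k i) && (S == [set i; j; k])])).
    by case: (e i j && _ && _); rewrite ?card1 ?card0.
  move=> S; rewrite !inE; apply/idP/idP.
    case/andP=> /andP[/eqP cardS /cliqueP clS] /and4P[iS /andP[ji jS] kj /andP[ki kS]].
    rewrite !clS 1?[i == j]eq_sym 1?[j == k]eq_sym //=.
    rewrite eq_sym eqEcard !subUset !sub1set iS jS kS cardS.
    by rewrite setUC cardsU1 cards2 !inE (negPf ki) (negPf kj) eq_sym ji.
  case/andP=> /andP[/andP[eij ejk] eki] /eqP->.
  have [ij jk ki] := And3 (neqE _ _ eij) (neqE _ _ ejk) (neqE _ _ eki).
  rewrite setUC cardsU1 cards2 ij !inE !eqxx !orbT [j == i]eq_sym (negPf ij).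
  rewrite [k == j]eq_sym (negPf jk) (negPf ki) !andbT /=.
  apply/cliqueP=> x y; rewrite !inE => /or3P[] /eqP-> /or3P[] /eqP->;
    by rewrite ?eqxx // symE.
under eq_bigr => i _ do under eq_bigr => j _ do under eq_bigr => k _ do rewrite triE.
under eq_bigr => i _ do under eq_bigr => j _ do rewrite exchange_big.
under eq_bigr => i _ do rewrite exchange_big.
rewrite exchange_big mulnC -sum_nat_const; apply: eq_bigr => S.
rewrite inE => /andP[/eqP cS _].
transitivity (\sum_(i in S) 2); last by rewrite sum_nat_const cS.
rewrite [RHS]big_mkcond /=.
apply: eq_bigr => i _.
case: ifP => iS; last by rewrite big1 // => j _; rewrite big1.
have cSi : #|S :\ i| = 2 by have := cardsD1 i S; rewrite cS iS => -[].
transitivity (\sum_(j in S :\ i) 1); last by rewrite sum_nat_const cSi.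
rewrite [RHS]big_mkcond /=.
apply: eq_bigr => j _.
case: ifP => jS; last by rewrite big1.
by rewrite sum_nat_bool; have := cardsD1 j (S :\ i); rewrite cSi jS => -[].
Qed.

Local Open Scope ring_scope.

(** * The Rayleigh bound for the smallest eigenvalue *)

Section Spectral.
Local Open Scope sesquilinear_scope.

(** Over the complex extension of [R] a symmetric matrix is Hermitian, hence unitarily
    diagonalizable. In coordinates of an eigenbasis the form is a sum of squared moduli with weights
    at least [mu]. *)
Lemma min_eigenvalue_le_rayleigh (R : rcfType) n (A : 'M[R]_n) mu (x : 'rV[R]_n) :
  A^T = A -> (forall a, eigenvalue A a -> mu <= a) ->
  mu * (x *m x^T) 0 0 <= (x *m A *m x^T) 0 0.
Proof.
move=> symA minA.
pose AC := map_mx (real_complex R) A.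
have realC m p (M : 'M[R]_(m, p)) : (map_mx (real_complex R) M)^t* =
    map_mx (real_complex R) M^T.
  apply/matrixP=> i j; rewrite !mxE /=.
  exact: conjc_real.
have symAC : AC \is hermsymmx.
  by apply/is_hermitianmxP; rewrite expr0 scale1r realC symA.
have /orthomx_spectralP := hermitian_normalmx symAC.
set P := spectralmx AC; set d := spectral_diag AC => ACE.
have Pu : P \is unitarymx := spectral_unitarymx AC.
rewrite invmx_unitary // in ACE.
(* Each diagonal entry is real and is an eigenvalue of [AC] with eigenvector [row i P], so its real
   part is an eigenvalue of [A] itself. *)
have le_d i : (real_complex R) mu <= d 0 i.
  have rd : d 0 i \is Num.real.
    by move/mxOverP: (hermitian_spectral_diag_real symAC); apply.
  have dE : d 0 i = (real_complex R) (complex.Re (d 0 i)).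
    by rewrite RRe_real.
  rewrite dE lecR; apply: minA.
  suff : eigenvalue AC (d 0 i) by rewrite dE /AC eigenvalue_map.
  apply/eigenvalueP; exists (row i P).
    rewrite [in LHS]ACE !mulmxA -row_mul (unitarymxP Pu) row1 -rowE row_diag_mx.
    by rewrite -scalemxAl -rowE.
  (* A zero row would contradict the diagonal entry 1 of [P *m P^t* = 1]. *)
  apply/eqP => Pi0; have := unitarymxP Pu => /matrixP/(_ i i).
  rewrite !mxE eqxx big1 => [|j _]; first by move/eqP; rewrite eq_sym oner_eq0.
  by move/rowP: Pi0 => /(_ j); rewrite !mxE => ->; rewrite mul0r.
rewrite -lecR rmorphM /=.
have entryE (M : 'M[R]_1) : (real_complex R) (M 0 0) =
    (map_mx (real_complex R) M) 0 0 by rewrite mxE.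
rewrite !entryE !map_mxM -realC -/AC /=.
set z := map_mx (real_complex R) x; pose y := z *m P^t*.
have zE : z = y *m P by rewrite /y mulmxKtV.
have yC : y^t* = P *m z^t* by rewrite trmx_mul map_mxM trmxCK.
have -> : z *m z^t* = y *m y^t* by rewrite yC mulmxA -zE.
have -> : z *m AC *m z^t* = y *m diag_mx d *m y^t*.
  by rewrite yC ACE !mulmxA.
rewrite !mxE mulr_sumr ler_sum // => i _.
have -> : (y *m diag_mx d) 0 i = d 0 i * y 0 i by rewrite mul_mx_diag mxE mulrC.
rewrite -mulrA ler_wpM2r ?le_d //.
by rewrite !mxE -normCK exprn_ge0.
Qed.

End Spectral.

(** * Equality in the Rayleigh bound, for vectors and for traces *)

Section Rayleigh.
Context (R : rcfType) (n : nat) (A : 'M[R]_n) (mu : R).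
Hypotheses (symA : A^T = A) (minA : forall a, eigenvalue A a -> mu <= a).

Lemma dot_ge0 (x : 'rV[R]_n) : 0 <= (x *m x^T) 0 0.
Proof. by rewrite mxE sumr_ge0 // => i _; rewrite mxE -expr2 sqr_ge0. Qed.

Lemma dot_eq0 (x : 'rV[R]_n) : ((x *m x^T) 0 0 == 0) = (x == 0).
Proof.
apply/eqP/eqP => [|->]; last by rewrite mul0mx mxE.
rewrite mxE => /eqP; rewrite psumr_eq0 => [|i _]; last first.
  by rewrite mxE -expr2 sqr_ge0.
move/allP=> x0; apply/rowP=> i; have := x0 i (mem_index_enum _).
by rewrite !mxE -expr2 sqrf_eq0 => /eqP.
Qed.

Lemma rayleigh_eq (x : 'rV[R]_n) :
  (x *m A *m x^T) 0 0 = mu * (x *m x^T) 0 0 -> x *m A = mu *: x.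
Proof.
move=> eqx; pose M := A - mu%:M.
have symM : M^T = M by rewrite linearB /= symA tr_scalar_mx.
have qM (y : 'rV_n) : (y *m M *m y^T) 0 0 = (y *m A *m y^T) 0 0 - mu * (y *m y^T) 0 0.
  by rewrite mulmxBr mul_mx_scalar mulmxBl -scalemxAl mxE [X in _ + X]mxE [X in - X]mxE.
have M_ge0 (y : 'rV_n) : 0 <= (y *m M *m y^T) 0 0.
  by rewrite qM subr_ge0 min_eigenvalue_le_rayleigh.
have xM0 : (x *m M *m x^T) 0 0 = 0 by rewrite qM eqx subrr.
suff : x *m M == 0 by rewrite mulmxBr mul_mx_scalar subr_eq0 => /eqP.
clearbody M; rewrite -dot_eq0; set y := x *m M.
set a := (y *m y^T) 0 0; set q := (y *m M *m y^T) 0 0.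
have a0 : 0 <= a := dot_ge0 y.
have q0 : 0 <= q := M_ge0 y.
(* The form is nonnegative along the line [x + t y], with zero value at [t = 0],
   so its slope [2 a] there must vanish. *)
have qt t : 0 <= 2 * t * a + t ^+ 2 * q.
  have -> : 2 * t * a + t ^+ 2 * q = ((x + t *: y) *m M *m (x + t *: y)^T) 0 0.
    have e1 : (y *m M *m x^T) 0 0 = a by rewrite /a /y [in RHS]trmx_mul symM !mulmxA.
    have -> : (x + t *: y)^T = x^T + t *: y^T by rewrite [LHS]linearD /= linearZ.
    rewrite !mulmxDl !mulmxDr -!scalemxAl -!scalemxAr -/y.
    have mxD (P Q : 'M[R]_1) : (P + Q) 0 0 = P 0 0 + Q 0 0 by rewrite mxE.
    have mxZ s (P : 'M[R]_1) : (s *: P) 0 0 = s * P 0 0 by rewrite mxE.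
    rewrite !(mxD, mxZ) e1 -/a -/q xM0; ring.
  exact: M_ge0.
have q1 : 0 < q + 1 by lra.
(* The minimizer would be [t = - a / q]; the denominator [q + 1] keeps [t] defined when [q = 0] and
   still makes the value negative unless [a = 0]. *)
have := qt (- a / (q + 1)).
have -> : 2 * (- a / (q + 1)) * a + (- a / (q + 1)) ^+ 2 * q =
   - (a ^+ 2 * ((q + 2) / (q + 1) ^+ 2)) by field; lra.
rewrite oppr_ge0 pmulr_lle0; last by rewrite divr_gt0 ?exprn_gt0 //; lra.
by move=> h; rewrite -sqrf_eq0 eq_le h sqr_ge0.
Qed.

Lemma mxtrace_row (B C : 'M[R]_n) :
  \tr (B *m C^T) = \sum_i (row i B *m (row i C)^T) 0 0.
Proof.
apply: eq_bigr => i _; rewrite !mxE; by apply: eq_bigr => j _; rewrite !mxE.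
Qed.

Lemma mxtrace_rayleigh (B : 'M[R]_n) :
  mu * \tr (B *m B^T) <= \tr (B *m A *m B^T).
Proof.
rewrite !mxtrace_row mulr_sumr ler_sum // => i _.
by rewrite row_mul min_eigenvalue_le_rayleigh.
Qed.

(** The two traces differ by a sum of nonnegative terms, one per row, so equality forces it in every
    row and [rayleigh_eq] applies. *)
Lemma mxtrace_rayleigh_eq (B : 'M[R]_n) :
  (\tr (B *m A *m B^T) == mu * \tr (B *m B^T)) = (B *m A == mu *: B).
Proof.
apply/eqP/eqP => [eqB|->]; last by rewrite -scalemxAl mxtraceZ.
apply/row_matrixP => i; rewrite row_mul linearZ /=; apply: rayleigh_eq.
have ge0 j : 0 <= (row j B *m A *m (row j B)^T) 0 0 - mu * (row j B *m (row j B)^T) 0 0.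
  by rewrite subr_ge0 min_eigenvalue_le_rayleigh.
have : \sum_j ((row j B *m A *m (row j B)^T) 0 0
           - mu * (row j B *m (row j B)^T) 0 0) == 0.
  rewrite sumrB -mulr_sumr -mxtrace_row -eqB mxtrace_row subr_eq0.
  by apply/eqP/eq_bigr => j _; rewrite row_mul.
rewrite psumr_eq0 // => /allP/(_ i (mem_index_enum _)).
by rewrite subr_eq0 => /eqP.
Qed.

End Rayleigh.

(** * Trace expansions after subtracting a multiple of [J] *)

Section Traces.
Context (R : comNzRingType) (n : nat).
Implicit Types (A M : 'M[R]_n) (c : R).
Local Notation J := (const_mx 1 : 'M[R]_n).

Lemma mxtrace_const1_mul M : \tr (J *m M) = \sum_i \sum_j M i j.
Proof.
rewrite exchange_big; apply: eq_bigr => i _; rewrite mxE.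
by apply: eq_bigr => j _; rewrite mxE mul1r.
Qed.

Lemma mul_const1 : J *m J = n%:R *: J.
Proof.
apply/matrixP=> i j; rewrite !mxE mulr1.
under eq_bigr do rewrite !mxE mulr1.
by rewrite sumr_const card_ord.
Qed.

Lemma mxtrace_shift2 A c :
  \tr ((A - c *: J) *m (A - c *: J)) =
  \tr (A *m A) - 2 * c * (\sum_i \sum_j A i j) + c ^+ 2 * n%:R ^+ 2.
Proof.
rewrite mulmxBl !mulmxBr -!scalemxAl -!scalemxAr mul_const1 !linearB /= !linearZ /=.
have -> : \tr J = n%:R.
  by rewrite /mxtrace; under eq_bigr do rewrite mxE; rewrite sumr_const card_ord.
by rewrite [\tr (A *m J)]mxtrace_mulC mxtrace_const1_mul; ring.
Qed.

Lemma mxtrace_shift3 A c :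
  \tr ((A - c *: J) *m A *m (A - c *: J)) =
  \tr (A *m A *m A) - 2 * c * (\sum_i \sum_j (A *m A) i j)
  + c ^+ 2 * n%:R * (\sum_i \sum_j A i j).
Proof.
rewrite mulmxBl !mulmxBr !mulmxBl -!scalemxAl -!scalemxAr !linearB /= !linearZ /=.
rewrite [\tr (J *m A *m J)]mxtrace_mulC mulmxA mul_const1 -scalemxAl linearZ /=.
rewrite [\tr (A *m A *m J)]mxtrace_mulC -[J *m A *m A]mulmxA !mxtrace_const1_mul.
by ring.
Qed.

End Traces.

(** * Traces of adjacency matrices and the bound *)

Section Graph.
Context (R : rcfType) (n : nat) (e : rel 'I_n).
Hypothesis graph_e : simple_graph e.
Local Notation A := (adj_mx R e).
Local Notation J := (const_mx 1 : 'M[R]_n).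

Lemma adj_mx_sym : A^T = A.
Proof. by case: graph_e => symE _; apply/matrixP=> i j; rewrite !mxE symE. Qed.

Lemma sum_adj : \sum_i \sum_j A i j = 2 * (num_edges e)%:R.
Proof.
rewrite -natrM -sum_edges // natr_sum; apply: eq_bigr => i _.
by rewrite natr_sum; apply: eq_bigr => j _; rewrite mxE.
Qed.

Lemma mxtrace_adj2 : \tr (A *m A) = 2 * (num_edges e)%:R.
Proof.
rewrite -sum_adj; apply: eq_bigr => i _; rewrite mxE; apply: eq_bigr => j _.
by case: graph_e => symE _; rewrite !mxE symE -natrM mulnb andbb.
Qed.

Lemma mxtrace_adj3 : \tr (A *m A *m A) = 6 * (num_triangles e)%:R.
Proof.
rewrite -natrM -sum_triangles // natr_sum; apply: eq_bigr => i _.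
rewrite mxE exchange_big natr_sum; apply: eq_bigr => k _.
rewrite mxE mulr_suml natr_sum; apply: eq_bigr => j _.
by rewrite !mxE -!natrM !mulnb.
Qed.

(** Both sides count walks of length 2; the right side groups them by their middle vertex. *)
Lemma sum_adj_sqr : \sum_i \sum_j (A *m A) i j = \sum_i (\sum_j A i j) ^+ 2.
Proof.
have symA i j : A i j = A j i by rewrite -{1}adj_mx_sym mxE.
under eq_bigr => i _ do under eq_bigr => j _ do rewrite mxE.
under eq_bigr => i _ do rewrite exchange_big /=.
rewrite exchange_big /=; apply: eq_bigr => k _.
rewrite expr2 mulr_suml; apply: eq_bigr => i _.
by rewrite -mulr_sumr symA.
Qed.

Lemma smallest_adj_eigenvalue_bound (mu : R) :
  (1 <= num_edges e)%N -> (forall a, eigenvalue A a -> mu <= a) ->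
  let m : R := (num_edges e)%:R in
  let t : R := (num_triangles e)%:R in
  let nn : R := n%:R in
  let F := (3 * nn ^+ 3 * t - 4 * m ^+ 3) / (nn * m * (nn ^+ 2 - 2 * m)) in
  let B := A - (2 * m / nn ^+ 2) *: J in
  [/\ mu <= F, 0 < \tr (B *m B) &
   (mu = F <-> B *m A = mu *: B /\ forall i, \sum_j A i j = 2 * m / nn)].
Proof.
move=> m_gt0 minA m t nn F B.
have [symE irrE] := graph_e.
have n_gt0 : (0 < n)%N.
  case: (posnP n) (sum_edges graph_e) => // n0; rewrite big1.
    by case: num_edges m_gt0.
  by move=> i; have := ltn_ord i; rewrite {2}n0.
have nn0 : 0 < nn by rewrite ltr0n.
have m0 : 0 < m by rewrite ltr0n.
have symB : B^T = B by rewrite linearB /= adj_mx_sym linearZ /= trmx_const.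
have trBB : \tr (B *m B) = 2 * m * (nn ^+ 2 - 2 * m) / nn ^+ 2.
  rewrite mxtrace_shift2 mxtrace_adj2 sum_adj -/m -/nn; field; lra.
(* As [A] has zero diagonal, the diagonal entries of [B] are [- 2 * m / nn ^+ 2], so [B] is nonzero.
   This also yields positivity of the factor [nn ^+ 2 - 2 * m] in the denominator of [F]. *)
have trBB0 : 0 < \tr (B *m B).
  rewrite -{2}symB mxtrace_row.
  have B_ge0 i : 0 <= (row i B *m (row i B)^T) 0 0 by apply: dot_ge0.
  rewrite lt_neqAle sumr_ge0 // andbT eq_sym psumr_eq0 //.
  apply/negP => /allP /(_ (Ordinal n_gt0) (mem_index_enum _)).
  rewrite dot_eq0 => /eqP/rowP/(_ (Ordinal n_gt0)).
  rewrite !mxE irrE add0r mulr1 => /eqP.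
  by rewrite oppr_eq0 gt_eqF // divr_gt0 ?exprn_gt0 ?mulr_gt0.
have N0 : 0 < nn ^+ 2 - 2 * m.
  by move: trBB0; rewrite trBB pmulr_lgt0 ?invr_gt0 ?exprn_gt0 // pmulr_rgt0 // mulr_gt0.
pose d i := \sum_j A i j.
(* [2 * m / nn] is the mean degree, so [V] measures the deviation from regularity and vanishes
   exactly for regular graphs. *)
pose V := \sum_i (d i - 2 * m / nn) ^+ 2.
have V0 : 0 <= V by rewrite sumr_ge0 // => i _; rewrite sqr_ge0.
have sumd2 : \sum_i d i ^+ 2 = V + 4 * m ^+ 2 / nn.
  have -> : V = \sum_i (d i ^+ 2 - (4 * m / nn) * d i + (2 * m / nn) ^+ 2).
    by apply: eq_bigr => i _; field; lra.
  rewrite big_split sumrB -mulr_sumr sum_adj sumr_const card_ord -/m -mulr_natr -/nn /=.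
  by field; lra.
(* The bound loses in two places: the [V] term here and the Rayleigh inequality for [B]. Equality
   means that both losses are zero. *)
have trBAB : \tr (B *m A *m B) = F * \tr (B *m B) - 4 * m / nn ^+ 2 * V.
  rewrite mxtrace_shift3 mxtrace_adj3 sum_adj_sqr sum_adj sumd2 trBB -/m -/nn -/t /F.
  by field; lra.
have c0 : 0 < 4 * m / nn ^+ 2 by rewrite divr_gt0 ?mulr_gt0 ?exprn_gt0.
have rayB := mxtrace_rayleigh adj_mx_sym minA B.
have := mxtrace_rayleigh_eq adj_mx_sym minA B; rewrite symB => eqB.
rewrite symB in rayB.
have cV0 : 0 <= 4 * m / nn ^+ 2 * V by rewrite mulr_ge0 // ltW.
have leF : mu * \tr (B *m B) <= F * \tr (B *m B).
  by rewrite (le_trans rayB) // trBAB gerBl.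
split=> //; first by rewrite -(ler_pM2r trBB0).
split=> [muF|[/eqP BA reg]].
  have V_eq0 : V == 0.
    rewrite eq_le V0 andbT -(pmulr_rle0 _ c0).
    by move: rayB; rewrite trBAB muF; lra.
  split.
    by apply/eqP; rewrite -eqB trBAB -muF (eqP V_eq0) mulr0 subr0.
  move=> i; move: V_eq0; rewrite psumr_eq0 => [|j _]; last by rewrite sqr_ge0.
  by move/allP/(_ i (mem_index_enum _)); rewrite sqrf_eq0 subr_eq0 => /eqP.
apply: (mulIf (lt0r_neq0 trBB0)).
rewrite -eqB trBAB in BA.
have V_eq0 : V = 0 by rewrite /V big1 // => i _; rewrite /d reg subrr expr0n.
by move/eqP: BA => <-; rewrite V_eq0 mulr0 subr0.
Qed.
End Graph.

(** * The equality case *)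

Lemma edge_exists n (e : rel 'I_n) : (1 <= num_edges e)%N ->
  simple_graph e -> exists x y, e x y.
Proof.
move=> m1 ge; have := sum_edges ge.
case: (pickP [pred p : 'I_n * 'I_n | e p.1 p.2]) => [[x y] /= exy _|no].
  by exists x, y.
rewrite big1 => [|i _]; first by case: num_edges m1.
by rewrite big1 // => j _; move: (no (i, j)) => /= ->.
Qed.

(** When nonadjacent vertices have the same neighbours, nonadjacency is an equivalence relation. Its
    classes are the parts, and regularity gives them all size [n - d]. *)
Lemma regular_complete_multipartite_of_twins n (e : rel 'I_n) d :
  simple_graph e -> (1 <= num_edges e)%N ->
  (forall x, #|[set y | e x y]| = d) ->
  (forall x y z, ~~ e x y -> e x z -> e y z) ->
  regular_complete_multipartite e.
Proof.
move=> ge m1 reg twin; have [symE irrE] := ge.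
have [x0 [y0 exy0]] := edge_exists m1 ge.
pose cl x := [set y | ~~ e x y].
have clE x y : (cl x == cl y) = ~~ e x y.
  apply/eqP/idP => [/setP/(_ y)|nexy]; first by rewrite !inE irrE.
  apply/setP => z; rewrite !inE; congr (~~ _).
  by apply/idP/idP; apply: twin; rewrite // symE.
pose P := [set cl x | x : 'I_n].
have clP x : cl x \in P by apply: imset_f.
pose f x : 'I_#|P| := enum_rank_in (clP x0) (cl x).
have fE x y : (f x == f y) = ~~ e x y.
  rewrite -clE; apply/eqP/eqP; last by rewrite /f => ->.
  by move/enum_rank_in_inj; apply.
have fS i : exists x, i = f x.
  have /imsetP[x _ ix] := enum_valP i; exists x.
  by rewrite /f -ix enum_valK_in.
have fib i : exists x, [set y | f y == i] = cl x.
  have [x ->] := fS i; exists x.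
  by apply/setP => y; rewrite !inE eq_sym fE.
exists #|P|, f; split.
(* With fewer than two classes, the ends of the edge [x0 y0] could not receive different labels. *)
- case: #|P| (f x0) (f y0) (fE x0 y0) => [[]//|[|//]] u v.
  by rewrite !ord1 eqxx exy0.
- move=> i; have [x ix] := fS i; rewrite card_gt0; apply/set0Pn; exists x.
  by rewrite inE ix.
- have cclE x : #|cl x| = (n - d)%N.
    rewrite -[n in RHS]card_ord -(cardsC [set y | e x y]) reg addKn.
    by apply: eq_card => y; rewrite !inE.
  by move=> i j; have [x ->] := fib i; have [y ->] := fib j; rewrite !cclE.
- by move=> x y; rewrite fE negbK.
Qed.

Section Equality.
Context (R : rcfType) (n : nat) (e : rel 'I_n).
Hypotheses (graph_e : simple_graph e) (m_gt0 : (1 <= num_edges e)%N).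
Local Notation A := (adj_mx R e).
Local Notation J := (const_mx 1 : 'M[R]_n).

Lemma regular_const1_mul_adj d : (forall i, \sum_j A i j = d) -> J *m A = d *: J.
Proof.
move=> reg; apply/matrixP=> i j; rewrite !mxE mulr1 -(reg j).
by apply: eq_bigr => k _; rewrite -[in LHS](adj_mx_sym R graph_e) !mxE mul1r.
Qed.

(** The hypotheses make [A *m A] a combination of [A] and [J], so the number of common neighbours of
    two vertices depends only on adjacency; the diagonal fixes its value for nonadjacent pairs. *)
Lemma regular_complete_multipartite_of_eq mu c d :
  (forall i, \sum_j A i j = d) ->
  (A - c *: J) *m A = mu *: (A - c *: J) ->
  regular_complete_multipartite e.
Proof.
have [symE irrE] := graph_e.
move=> reg; rewrite mulmxBl -scalemxAl (regular_const1_mul_adj reg) scalerBr => eA.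
have AA i j : (A *m A) i j = mu * A i j + c * (d - mu).
  move/matrixP/(_ i j): eA; rewrite mxE [X in _ + X]mxE [in RHS]mxE.
  rewrite [X in _ = _ + X]mxE !mxE !mulr1 => /eqP; rewrite subr_eq => /eqP ->.
  by ring.
have AAd i : (A *m A) i i = d.
  rewrite mxE -(reg i); apply: eq_bigr => j _.
  by rewrite !mxE symE -natrM mulnb andbb.
have cd : c * (d - mu) = d.
  have [x [y _]] := edge_exists m_gt0 graph_e.
  by have := AA x x; rewrite AAd mxE irrE mulr0 add0r => /esym.
have degE i : d = #|[set j | e i j]|%:R.
  rewrite -(reg i) -sum1dep_card natr_sum [RHS]big_mkcond /=.
  by apply: eq_bigr => j _; rewrite mxE; case: (e i j).
have [x0 [y0 exy0]] := edge_exists m_gt0 graph_e.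
apply: (@regular_complete_multipartite_of_twins _ _ #|[set j | e x0 j]|)
  => // [x|x y z nexy exz].
  by apply/eqP; rewrite -(eqr_nat R) -!degE.
(* The sum counts neighbours of [x] that are not adjacent to [y]; it is [d - d = 0], so each of its
   nonnegative terms vanishes. *)
have : \sum_k A x k * (1 - A k y) == 0.
  under eq_bigr do rewrite mulrBr mulr1.
  rewrite sumrB reg subr_eq0; have := AA x y; rewrite cd [in LHS]mxE => ->.
  by rewrite mxE (negPf nexy) mulr0 add0r.
rewrite psumr_eq0 => [|k _]; last first.
  by rewrite !mxE; case: (e x k); case: (e k y); rewrite ?subrr ?subr0
                  ?mulr1 ?mulr0 ?mul0r ?ler01.
move/allP/(_ z (mem_index_enum _)); rewrite !mxE exz mul1r symE.
by case: (e y z) => //; rewrite subr0 oner_eq0.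
Qed.

Lemma multipartite_adj_sqr : regular_complete_multipartite e ->
  exists2 s : R, 0 < s &
    (forall i, \sum_j A i j = n%:R - s) /\ A *m A = (n%:R - s) *: J - s *: A.
Proof.
case=> k [f [_ pos_f reg_f ef]].
have [x0 _] := edge_exists m_gt0 graph_e.
pose sz := #|[set x | f x == f x0]|; exists sz%:R; first by rewrite ltr0n pos_f.
(* [K] is the indicator of lying in the same part. Equal part sizes give [K] constant row sums and
   [K *m K = sz%:R *: K]. *)
pose K : 'M[R]_n := \matrix_(i, j) (f i == f j)%:R.
have AE : A = J - K.
  by apply/matrixP=> i j; rewrite !mxE ef; case: eqP; rewrite ?subrr ?subr0.
have sumK i : \sum_j K i j = sz%:R.
  rewrite -[sz](reg_f (f i)) -sum1dep_card natr_sum [RHS]big_mkcond /=.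
  by apply: eq_bigr => j _; rewrite mxE eq_sym; case: eqP.
have symK i j : K i j = K j i by rewrite !mxE eq_sym.
have JK : J *m K = sz%:R *: J.
  apply/matrixP=> i j; rewrite !mxE mulr1 -(sumK j).
  by apply: eq_bigr => l _; rewrite mxE mul1r symK.
have KJ : K *m J = sz%:R *: J.
  apply/matrixP=> i j; rewrite !mxE mulr1 -(sumK i).
  by apply: eq_bigr => l _; rewrite !mxE mulr1.
have KK : K *m K = sz%:R *: K.
  apply/matrixP=> i j; rewrite !mxE -(sumK i) mulr_suml.
  apply: eq_bigr => l _; rewrite !mxE.
  by case: (f i =P f l) => [->|]; rewrite ?mul0r.
split=> [i|].
  rewrite AE; under eq_bigr do rewrite mxE [X in _ + X]mxE.
  rewrite sumrB sumK; congr (_ - _).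
  by under eq_bigr do rewrite mxE; rewrite sumr_const card_ord.
rewrite AE mulmxBl !mulmxBr mul_const1 JK KJ KK.
by apply/matrixP => i j; rewrite !mxE; ring.
Qed.

(** The formula for [A *m A] gives [B *m A = - s *: B]; what remains is that the smallest eigenvalue
    [mu] is [- s]. *)
Lemma multipartite_mul_adj_shift mu (c := 2 * (num_edges e)%:R / n%:R ^+ 2 : R)
    (B := A - c *: J) :
  is_smallest_adj_eigenvalue e mu -> 0 < \tr (B *m B) ->
  regular_complete_multipartite e ->
  B *m A = mu *: B /\ forall i, \sum_j A i j = 2 * (num_edges e)%:R / n%:R.
Proof.
case=> /eigenvalueP[v vA v0] minA trB /multipartite_adj_sqr[s s0 [reg AA]].
have [x0 _] := edge_exists m_gt0 graph_e.
have n0 : 0 < n%:R :> R by rewrite ltr0n (leq_ltn_trans _ (ltn_ord x0)).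
have mE : 2 * (num_edges e)%:R = n%:R * (n%:R - s).
  rewrite -(sum_adj R graph_e); under eq_bigr do rewrite reg.
  by rewrite sumr_const card_ord -[LHS]mulr_natl.
have cE : c = (n%:R - s) / n%:R by rewrite /c mE; field; rewrite gt_eqF.
have JA := regular_const1_mul_adj reg.
have BA : B *m A = - s *: B.
  rewrite mulmxBl -scalemxAl JA AA /B cE.
  by apply/matrixP => i j; rewrite !mxE; field; rewrite gt_eqF.
(* A positive trace forces a nonzero row of [B], which is an eigenvector for [- s]. *)
have mu_s : mu <= - s.
  apply: minA; have [i Bi] : exists i, row i B != 0.
    apply/existsP; apply: contraTT trB => /existsPn Bi0.
    suff -> : B = 0 by rewrite mul0mx mxtrace0 ltxx.
    by apply/row_matrixP => i; rewrite row0; apply/eqP/negPn/Bi0.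
  by apply/eigenvalueP; exists (row i B) => //; rewrite -row_mul BA linearZ.
have d0 : 0 <= n%:R - s by rewrite -(reg x0) sumr_ge0 // => j _; rewrite mxE.
have symA := adj_mx_sym R graph_e.
have AB : A *m B = - s *: B.
  have symB : B^T = B by rewrite linearB /= symA linearZ /= trmx_const.
  by rewrite -[LHS]trmxK trmx_mul symA symB BA linearZ /= symB.
have AJ : A *m J = (n%:R - s) *: J.
  by rewrite -[LHS]trmxK trmx_mul symA trmx_const JA linearZ /= trmx_const.
(* If [mu] differs from [- s], then [v] is annihilated by [B], and also by [J] since
   [mu <= - s < 0 <= n%:R - s]. Hence [v *m A = 0], which contradicts [mu < 0] and [v != 0]. *)
have muE : mu = - s.
  apply/eqP; apply: contraNT v0 => mu_ns.
  have vB : v *m B = 0.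
    apply/eqP; have : (mu + s) *: (v *m B) == 0.
      by rewrite scalerDl scalemxAl -vA -mulmxA AB -scalemxAr scaleNr addNr.
    by rewrite scaler_eq0 addr_eq0 (negPf mu_ns).
  have vJ : v *m J = 0.
    apply/eqP; have : (mu - (n%:R - s)) *: (v *m J) == 0.
      by rewrite scalerBl scalemxAl -vA -mulmxA AJ -scalemxAr subrr.
    rewrite scaler_eq0 => /orP[|//]; rewrite subr_eq0 => /eqP; lra.
  have : mu *: v == 0.
    by rewrite -vA -[A](subrK (c *: J)) mulmxDr -/B vB -scalemxAr vJ scaler0 addr0.
  by rewrite scaler_eq0 => /orP[/eqP|//]; lra.
split; first by rewrite BA muE.
by move=> i; rewrite reg mE; field; rewrite gt_eqF.
Qed.
End Equality.

Theorem theorem3 (R : rcfType) (n : nat) (e : rel 'I_n) (mu : R) :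
  simple_graph e ->
  (1 <= num_edges e)%N ->
  @is_smallest_adj_eigenvalue R n e mu ->
  let m : R := (num_edges e)%:R in
  let t : R := (num_triangles e)%:R in
  let nn : R := n%:R in
  (mu <= (3 * nn ^+ 3 * t - 4 * m ^+ 3) / (nn * m * (nn ^+ 2 - 2 * m))) /\
  (mu = (3 * nn ^+ 3 * t - 4 * m ^+ 3) / (nn * m * (nn ^+ 2 - 2 * m))
     <-> regular_complete_multipartite e).
Proof.
move=> ge m1 minmu m t nn; have [eig minA] := minmu.
have [leF trB eqF] := smallest_adj_eigenvalue_bound ge m1 minA.
split=> //; split=> [/eqF[eA reg]|mp].
  exact: (regular_complete_multipartite_of_eq ge m1 reg eA).
by apply/eqF; apply: multipartite_mul_adj_shift.
Qed.
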